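(* Let $A$ be a $V\times V$ symmetric or skew-symmetric matrix over some field. Then $d_{\mathcal{M}_A}(X)=n(A[X])$ for every $X\subseteq V$.
   Context: $V$ is a finite set, and a $V\times V$ matrix has its rows and columns indexed by $V$. $A$ is skew-symmetric if $A^T=-A$ (no condition on the diagonal is imposed beyond this, so in characteristic $2$ nonzero diagonal entries are allowed). For $X\subseteq V$, $A[X]$ is the principal submatrix of $A$ with rows and columns in $X$; by convention the empty matrix $A[\varnothing]$ is nonsingular (with nullity $0$). $n(B)$ denotes the nullity (dimension of the null space) of a matrix $B$. A set system is a pair $M=(V,D)$ with $D$ a family of subsets of $V$; it is proper if $D\neq\varnothing$. $\mathcal{M}_A=(V,D_A)$ is the set system with $D_A=\{X\subseteq V\mid A[X]\text{ is nonsingular}\}$. For a proper set system $M=(V,D)$ and $X\subseteq V$, $d_M(X)=\min\{|X\triangle Y|\mid Y\in D\}$, where $\triangle$ denotes symmetric difference. *)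

(* Defs.v *)
From HB Require Import structures.
From mathcomp Require Import all_boot all_order all_algebra.

Set Implicit Arguments.
Unset Strict Implicit.
Unset Printing Implicit Defensive.

Import GRing.Theory.

Local Open Scope ring_scope.

(* A V x V matrix over F is an 'M[F]_#|V|, the element x : V labelling the row
   and the column of index enum_rank x. *)

Definition principal_submx (F : fieldType) (V : finType) (A : 'M[F]_#|V|)
    (X : {set V}) : 'M[F]_#|X| :=
  mxsub (fun i : 'I_#|X| => enum_rank (enum_val i))
        (fun j : 'I_#|X| => enum_rank (enum_val j)) A.

(* kermx is the kernel for left multiplication by row vectors, so the null
   space {v | B v = 0} is the row space of kermx B^T. *)
Definition nullity (F : fieldType) (m n : nat) (B : 'M[F]_(m, n)) : nat :=
  \rank (kermx B^T).

(* A set system (V, D) is given by its family D. *)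
Definition set_system (V : finType) := {set {set V}}.

Definition proper_system (V : finType) (D : set_system V) : bool :=
  D != set0.

Definition symdiff (V : finType) (X Y : {set V}) : {set V} :=
  (X :\: Y) :|: (Y :\: X).

(* The default #|V| bounds every #|symdiff X Y|, so for a proper D this is the
   minimum over D (see system_dist_attained and system_dist_le); it is
   meaningful only for proper D. *)
Definition system_dist (V : finType) (D : set_system V) (X : {set V}) : nat :=
  \big[minn/#|V|]_(Y in D) #|symdiff X Y|.

Definition mx_system (F : fieldType) (V : finType) (A : 'M[F]_#|V|) :
    set_system V :=
  [set X : {set V} | principal_submx A X \in unitmx].

Lemma system_dist_le (V : finType) (D : set_system V) (X Y : {set V}) :
  Y \in D -> (system_dist D X <= #|symdiff X Y|)%N.
Proof.
move=> DY; rewrite /system_dist.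
elim: (index_enum _) (mem_index_enum Y) => //= Z s IHs.
rewrite inE big_cons => /predU1P[<-|/IHs le_s]; first by rewrite DY geq_minl.
by case: ifP => // _; rewrite geq_min le_s orbT.
Qed.

Lemma system_dist_attained (V : finType) (D : set_system V) (X : {set V}) :
  proper_system D -> exists2 Y, Y \in D & system_dist D X = #|symdiff X Y|.
Proof.
case/set0Pn=> Y0 DY0.
have [Y DY minY] := arg_minnP (fun Y => #|symdiff X Y|) DY0.
exists Y => //; apply/eqP; rewrite eqn_leq system_dist_le //=.
rewrite /system_dist; elim/big_ind: _ => [|m n lem len|Z DZ].
- exact: max_card.
- by rewrite leq_min lem.
- exact: minY.
Qed.

Lemma mx_system_proper (F : fieldType) (V : finType) (A : 'M[F]_#|V|) :
  proper_system (mx_system A).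
Proof.
apply/set0Pn; exists set0; rewrite inE unitmxE.
by move: (principal_submx A set0); rewrite cards0 => B; rewrite det_mx00 unitr1.
Qed.

(* Main.v *)
(** If [A[Y]] is nonsingular, discarding from it the rows and columns outside [X]
    lowers the rank by at most [2 * #|Y :\: X|], so [\rank A[X] >= #|Y| - 2 * #|Y :\: X|],
    that is, the nullity of [A[X]] is at most [#|symdiff X Y|].  Conversely, if [Y]
    indexes a basis of the row space of [A[X]], then by (skew-)symmetry [Y] also
    indexes a basis of its column space; hence [A[Y]] is nonsingular, and
    [#|X :\: Y|] is the nullity of [A[X]]. *)
Require Import Defs.
From HB Require Import structures.
From mathcomp Require Import all_boot all_order all_algebra.

Set Implicit Arguments.
Unset Strict Implicit.
Unset Printing Implicit Defensive.

Import GRing.Theory.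

Local Open Scope ring_scope.

(** Names the index map inside [principal_submx], so that [principal_submx A X] is convertible to
    [mxsub] along [@set_index V X] on both sides. *)
Definition set_index (V : finType) (X : {set V}) (i : 'I_#|X|) : 'I_#|V| :=
  enum_rank (enum_val i).

Lemma nullityE (F : fieldType) m n (B : 'M[F]_(m, n)) :
  nullity B = (n - \rank B)%N.
Proof. by rewrite /nullity mxrank_ker mxrank_tr. Qed.

Lemma mxrank_rowsub_le (F : fieldType) m n p (f : 'I_p -> 'I_m)
    (B : 'M[F]_(m, n)) : (\rank (rowsub f B) <= \rank B)%N.
Proof. exact/mxrankS/rowsub_sub. Qed.

Lemma mxrank_colsub_le (F : fieldType) m n p (f : 'I_p -> 'I_n)
    (B : 'M[F]_(m, n)) : (\rank (colsub f B) <= \rank B)%N.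
Proof. by rewrite -mxrank_tr -[leqRHS]mxrank_tr trmx_mxsub mxrank_rowsub_le. Qed.

Lemma mxrank_mxsub_le (F : fieldType) m n p q (f : 'I_p -> 'I_m)
    (g : 'I_q -> 'I_n) (B : 'M[F]_(m, n)) :
  (\rank (mxsub f g B) <= \rank B)%N.
Proof.
have -> : mxsub f g B = rowsub f (colsub g B) by apply/matrixP=> i j; rewrite !mxE.
exact: leq_trans (mxrank_rowsub_le _ _) (mxrank_colsub_le _ _).
Qed.

(** Each row indexed by [Y] is either indexed by [X] or one of the [#|Y :\: X|] remaining rows,
    which span a space of at most that dimension. *)
Lemma mxrank_rowsub_setD (F : fieldType) (V : finType) n (B : 'M[F]_(#|V|, n))
    (X Y : {set V}) :
  (\rank (rowsub (@set_index V Y) B)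
     <= \rank (rowsub (@set_index V X) B) + #|Y :\: X|)%N.
Proof.
set BX := rowsub (@set_index V X) B.
pose BD := rowsub (@set_index V (Y :\: X)) B.
have sub : (rowsub (@set_index V Y) B <= BX + BD)%MS.
  apply/row_subP=> i; rewrite row_rowsub.
  have row_in (Z : {set V}) : enum_val i \in Z ->
      (row (set_index i) B <= rowsub (@set_index V Z) B)%MS.
    move=> Zi.
    have -> : set_index i = set_index (enum_rank_in Zi (enum_val i)).
      by rewrite /set_index enum_rankK_in.
    by rewrite -row_rowsub row_sub.
  have [Xi|nXi] := boolP (enum_val i \in X).
    exact: submx_trans (row_in _ Xi) (addsmxSl _ _).
  apply: submx_trans (row_in (Y :\: X) _) (addsmxSr _ _).
  by rewrite inE nXi enum_valP.
apply: leq_trans (mxrankS sub) (leq_trans (mxrank_adds_leqif _ _) _).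
by rewrite leq_add2l rank_leq_row.
Qed.

(** Replace [Y] by [X] first in the rows, then in the columns (the row bound for [A^T]); each
    replacement costs [#|Y :\: X|]. *)
Lemma mxrank_principal_setD (F : fieldType) (V : finType) (A : 'M[F]_#|V|)
    (X Y : {set V}) :
  (\rank (principal_submx A Y)
     <= \rank (principal_submx A X) + #|Y :\: X|.*2)%N.
Proof.
have rowsD := mxrank_rowsub_setD (colsub (@set_index V Y) A) X Y.
have colsD := mxrank_rowsub_setD (colsub (@set_index V X) A^T) X Y.
have rcE (Z W : {set V}) (B : 'M[F]_#|V|) :
    rowsub (@set_index V Z) (colsub (@set_index V W) B) =
    mxsub (@set_index V Z) (@set_index V W) B.
  by apply/matrixP=> i j; rewrite !mxE.
rewrite !rcE in rowsD colsD.
rewrite -!trmx_mxsub !mxrank_tr in colsD.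
by rewrite -addnn addnA (leq_trans rowsD) // leq_add2r.
Qed.

Lemma card_symdiff (V : finType) (X Y : {set V}) :
  #|symdiff X Y| = (#|X :\: Y| + #|Y :\: X|)%N.
Proof.
rewrite /symdiff cardsU [_ :&: _](_ : _ = set0) ?cards0 ?subn0 //.
by apply/setP=> x; rewrite !inE; do 2!case: (x \in _).
Qed.

Lemma nullity_principal_le (F : fieldType) (V : finType) (A : 'M[F]_#|V|)
    (X Y : {set V}) : principal_submx A Y \in unitmx ->
  (nullity (principal_submx A X) <= #|symdiff X Y|)%N.
Proof.
move=> /mxrank_unit rkY; rewrite nullityE card_symdiff leq_subLR.
have := mxrank_principal_setD A X Y; rewrite rkY -addnn addnA.
(* Splitting [#|Y|] along [X] cancels one of the two copies of [#|Y :\: X|]; adding [#|X :\: Y|] to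
   both sides then turns [#|X :&: Y|] into [#|X|]. *)
rewrite -[leqLHS](cardsID X Y) leq_add2r setIC => le_rk.
by rewrite -[leqLHS](cardsID Y X) addnCA addnC leq_add2l.
Qed.

(** The hypothesis is what symmetry and skew-symmetry have in common. Let [R = rowsub f B] be the
    row basis selected by [f = maxrankfun B]. Then [B^T = C *m R] for some [C], so [B = R^T *m C^T];
    keeping only the rows in [f] gives [R = (mxsub f f B)^T *m C^T], which bounds
    [\rank R = \rank B]. *)
Lemma mxrank_maxrankfun_principal (F : fieldType) n (B : 'M[F]_n) :
  (B^T <= B)%MS ->
  \rank (mxsub (maxrankfun B) (maxrankfun B) B) = \rank B.
Proof.
set f := maxrankfun B => subB; apply/eqP.
rewrite eqn_leq mxrank_mxsub_le /= -[leqLHS](eq_maxrowsub B) -/f.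
have /submxP[C defBt] : (B^T <= rowsub f B)%MS by rewrite eq_maxrowsub.
have defB : B = (rowsub f B)^T *m C^T by rewrite -trmx_mul -defBt trmxK.
have -> : rowsub f B = (mxsub f f B)^T *m C^T.
  have -> : (mxsub f f B)^T = rowsub f (rowsub f B)^T.
    by apply/matrixP=> i j; rewrite !mxE.
  by rewrite mul_rowsub_mx -defB.
by rewrite -[leqRHS]mxrank_tr mxrankM_maxl.
Qed.

Theorem theorem6p2 (F : fieldType) (V : finType) (A : 'M[F]_#|V|)
    (hA : A^T = A \/ A^T = - A) (X : {set V}) :
  system_dist (mx_system A) X = nullity (principal_submx A X).
Proof.
apply/eqP; rewrite eqn_leq; apply/andP; split; last first.
  have [Y + ->] := system_dist_attained X (mx_system_proper A).
  by rewrite inE; apply: nullity_principal_le.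
set B := principal_submx A X.
have symB : (B^T <= B)%MS.
  rewrite /B /principal_submx trmx_mxsub; case: hA => -> //.
  have -> f g : mxsub f g (- A) = - mxsub f g A by apply/matrixP=> i j; rewrite !mxE.
  by rewrite eqmx_opp.
have rkB := mxrank_maxrankfun_principal symB; set f := maxrankfun B in rkB.
have f_inj : injective f := @maxrankfun_inj _ _ _ B.
(* [f] takes values in the indices of [B], that is, positions in [X]; [g] carries them back to
   elements of [V]. *)
pose g i := enum_val (f i); pose Y := [set g i | i : 'I_(\rank B)].
have cardY : #|Y| = \rank B.
  by rewrite card_imset ?card_ord // => i j /enum_val_inj/f_inj.
have gY i : g i \in Y by apply: imset_f.
have subYX : Y \subset X by apply/subsetP=> _ /imsetP[i _ ->]; apply: enum_valP.
have unitY : Y \in mx_system A.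
  rewrite inE -row_free_unit -row_leq_rank [leqLHS]cardY -[leqLHS]rkB.
  (* The enumeration of [Y] may order the basis differently from [f]. Reindexing by [h] exhibits
     [mxsub f f B], of rank [#|Y|], as a submatrix of [A[Y]], which therefore has full rank. *)
  pose h i := enum_rank_in (gY i) (g i).
  rewrite [mxsub f f B](_ : _ = mxsub h h (principal_submx A Y)).
    exact: mxrank_mxsub_le.
  by apply/matrixP=> i j; rewrite !mxE !enum_rankK_in.
apply: leq_trans (system_dist_le X unitY) _.
rewrite nullityE card_symdiff (eqP (_ : Y :\: X == set0)) ?setD_eq0 //.
by rewrite cards0 addn0 cardsDS // cardY.
Qed.
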